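(* Let $X$ be a set and let $G$ be a topological subgroup of $\mathrm{Sym}(X)$. Furthermore, let $H$ be any non-trivial amenable group and endow the group $H^{(X)}$ with the discrete topology. Then the following are equivalent. (1) The action of $G$ on $X$ is extensively amenable. (2) The topological group $H^{(X)} \rtimes G$ is skew-amenable.
   Context: Skew-amenability. For a topological group $G$ and $g\in G$ let $\lambda_g\colon G\to G,\ x\mapsto gx$. Let $\mathrm{LUCB}(G)$ be the algebra of all bounded functions $f\colon G\to\mathbb{R}$ that are left-uniformly continuous, i.e., for every $\epsilon>0$ there is a neighborhood $U$ of the neutral element with $|f(x)-f(y)|\le\epsilon$ whenever $x,y \in G$ and $x^{-1}y\in U$. A mean on a linear subspace $A\subseteq\ell^\infty(Z)$ containing the constant function $\mathbf 1$ ($Z$ a set, $\ell^\infty(Z)$ the bounded real-valued functions) is a positive linear functional $\mu\colon A\to\mathbb{R}$ with $\mu(\mathbf 1)=1$. The group $G$ is skew-amenable if $\mathrm{LUCB}(G)$ admits a mean $\mu$ with $\mu(f\circ\lambda_g)=\mu(f)$ for all $f\in\mathrm{LUCB}(G)$, $g\in G$. $\mathrm{Sym}(X)$ is the group of all permutations of $X$ with the topology of pointwise convergence associated with the discrete topology on $X$; a topological subgroup is a subgroup with the subspace topology. The group $H$ in the statement is amenable as a discrete group. For a group $H$, $H^{(X)}=\bigoplus_X H$ is the group of finitely supported functions $X\to H$. A group $G$ acting on $X$ acts on $H^{(X)}$ by $(g\boldsymbol{.}f)(x)=f(g^{-1}x)$; $H^{(X)}\rtimes G$ is the semi-direct product with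 multiplication $(f,g)(f',g')=(f\cdot(g\boldsymbol{.}f'),gg')$, endowed with the product of the topologies of $H^{(X)}$ and $G$. It acts on $H^{(X)}$ by $((f,g),f')\mapsto f\cdot(g\boldsymbol{.}f')$. The action of $G$ on $X$ is extensively amenable if $\ell^\infty((\mathbb{Z}/2\mathbb{Z})^{(X)})$ admits a mean invariant under this action of $(\mathbb{Z}/2\mathbb{Z})^{(X)}\rtimes G$ on $(\mathbb{Z}/2\mathbb{Z})^{(X)}$. *)

(* Defs.v *)
From HB Require Import structures.
From mathcomp Require Import all_boot all_order all_algebra finmap.
From mathcomp Require Import all_classical all_reals all_analysis.

Set Implicit Arguments.
Unset Strict Implicit.
Unset Printing Implicit Defensive.

Import Order.TTheory GRing.Theory Num.Theory.
Import numFieldNormedType.Exports.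

Local Open Scope classical_set_scope.
Local Open Scope group_scope.

HB.mixin Record isTopGroup G & Topological G & Group G := {
  mulg_continuous : continuous (fun x : G * G => x.1 * x.2) ;
  invg_continuous : continuous (fun x : G => x^-1)
}.

#[short(type="topGroupType")]
HB.structure Definition TopGroup :=
  {G of Topological G & Group G & isTopGroup G}.

Lemma cvg_initial_topology (S : choiceType) (T : topologicalType) (f : S -> T)
    (F : set_system S) (s : S) : Filter F ->
  F --> (s : initial_topology f) <-> f @ F --> f s.
Proof.
move=> FF; split=> [cvFs|cvfFfs].
  apply: (cvg_trans (G := f @ (nbhs (s : initial_topology f)))).
    exact: cvg_app.
  exact: initial_continuous.
move=> A [_ [[B oB <-] Bfs] BA].
by apply: filterS BA _; apply: cvfFfs; exact: open_nbhs_nbhs.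
Qed.

Section Subgroup.
Variables (T : topGroupType) (S : groupClosed T).

Record subgroup := Subgroup {
  subgroup_val : T ;
  subgroup_valP : subgroup_val \in S
}.

HB.instance Definition _ := [isSub for subgroup_val].
HB.instance Definition _ := [Choice of subgroup by <:].

Implicit Types x y z : subgroup.

Lemma subgroup_inj x y : subgroup_val x = subgroup_val y -> x = y.
Proof. exact: val_inj. Qed.

Definition subgroup_one : subgroup := Subgroup gpred1.

Definition subgroup_mul x y : subgroup :=
  Subgroup (gpredM _ _ (subgroup_valP x) (subgroup_valP y)).

Definition subgroup_inv x : subgroup :=
  Subgroup (gpredVr _ (subgroup_valP x)).

Fact subgroup_mulA : associative subgroup_mul.
Proof. by move=> x y z; apply: subgroup_inj; exact: mulgA. Qed.

Fact subgroup_mul1 : left_id subgroup_one subgroup_mul.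
Proof. by move=> x; apply: subgroup_inj; exact: mul1g. Qed.

Fact subgroup_1mul : right_id subgroup_one subgroup_mul.
Proof. by move=> x; apply: subgroup_inj; exact: mulg1. Qed.

Fact subgroup_mulV : left_inverse subgroup_one subgroup_inv subgroup_mul.
Proof. by move=> x; apply: subgroup_inj; exact: mulVg. Qed.

Fact subgroup_Vmul : right_inverse subgroup_one subgroup_inv subgroup_mul.
Proof. by move=> x; apply: subgroup_inj; exact: mulgV. Qed.

HB.instance Definition _ := isGroup.Build subgroup
  subgroup_mulA subgroup_mul1 subgroup_1mul subgroup_mulV subgroup_Vmul.

HB.instance Definition _ :=
  Topological.copy subgroup (initial_topology subgroup_val).

Lemma subgroup_val_continuous : continuous subgroup_val.
Proof. exact: initial_continuous. Qed.

Fact subgroup_mul_continuous :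
  continuous (fun x : subgroup * subgroup => x.1 * x.2).
Proof.
move=> x; apply/cvg_initial_topology.
apply: (@continuous_comp _ _ _
  (fun y : subgroup * subgroup => (subgroup_val y.1, subgroup_val y.2))
  (fun z : T * T => z.1 * z.2) x).
  apply: cvg_pair => /=.
    apply: (@continuous_comp _ _ _ fst subgroup_val x); first exact: cvg_fst.
    exact: subgroup_val_continuous.
  apply: (@continuous_comp _ _ _ snd subgroup_val x); first exact: cvg_snd.
  exact: subgroup_val_continuous.
exact: (@mulg_continuous T (subgroup_val x.1, subgroup_val x.2)).
Qed.

Fact subgroup_inv_continuous : continuous (fun x : subgroup => x^-1).
Proof.
move=> x; apply/cvg_initial_topology.
  by apply: fmap_filter; exact: (@nbhs_filter subgroup x).
apply: (@continuous_comp _ _ _ subgroup_val (fun z : T => z^-1) x).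
  exact: subgroup_val_continuous.
exact: (@invg_continuous T (subgroup_val x)).
Qed.

HB.instance Definition _ :=
  isTopGroup.Build subgroup subgroup_mul_continuous subgroup_inv_continuous.

End Subgroup.

Record Sym (X : Type) := MkSym {
  sym_fun :> X -> X ;
  sym_inv : X -> X ;
  symK : cancel sym_fun sym_inv ;
  symVK : cancel sym_inv sym_fun
}.

Lemma symP (X : Type) (s t : Sym X) : s =1 t -> s = t.
Proof.
case: s t => [s s' sK s'K] [t t' tK t'K] /= /funext st.
subst t; have st' : s' = t'.
  by apply/funext => x; rewrite -{1}(t'K x) sK.
by subst t'; congr MkSym; exact: Prop_irrelevance.
Qed.

HB.instance Definition _ (X : Type) := gen_eqMixin (Sym X).
HB.instance Definition _ (X : Type) := gen_choiceMixin (Sym X).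

Section SymGroup.
Variable X : Type.
Implicit Types s t : Sym X.

Definition sym_one : Sym X :=
  @MkSym X id id (fun=> erefl) (fun=> erefl).

Definition sym_mul s t : Sym X :=
  @MkSym X (s \o t) (sym_inv t \o sym_inv s)
    (can_comp (symK s) (symK t)) (can_comp (symVK t) (symVK s)).

Definition sym_opp s : Sym X := @MkSym X (sym_inv s) s (symVK s) (symK s).

Fact sym_mulA : associative sym_mul.
Proof. by move=> s t u; exact: symP. Qed.

Fact sym_mul1 : left_id sym_one sym_mul.
Proof. by move=> s; exact: symP. Qed.

Fact sym_1mul : right_id sym_one sym_mul.
Proof. by move=> s; exact: symP. Qed.

Fact sym_mulV : left_inverse sym_one sym_opp sym_mul.
Proof. by move=> s; apply: symP => x /=; rewrite symK. Qed.

Fact sym_Vmul : right_inverse sym_one sym_opp sym_mul.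
Proof. by move=> s; apply: symP => x /=; rewrite symVK. Qed.

HB.instance Definition _ := isGroup.Build (Sym X)
  sym_mulA sym_mul1 sym_1mul sym_mulV sym_Vmul.

End SymGroup.

Section SymTopology.
Variable X : choiceType.

Definition sym_ptws (s : Sym X) : {ptws X -> discrete_topology X} := s.

HB.instance Definition _ :=
  Topological.copy (Sym X) (initial_topology sym_ptws).

Lemma sym_cvgP (F : set_system (Sym X)) (s : Sym X) : Filter F ->
  F --> s <-> forall x, F [set t : Sym X | t x = s x].
Proof.
move=> FF; have Fm : Filter (sym_ptws @ F) by exact: fmap_filter.
split=> [/cvg_initial_topology /cvg_sup Fs x|Fs].
  have /cvg_initial_topology := Fs x.
  by move/(_ [set s x]); apply; exact: discrete_set1.
apply/cvg_initial_topology/cvg_sup => x; apply/cvg_initial_topology.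
by apply/discrete_cvg; exact: Fs.
Qed.

Lemma sym_nbhs (s : Sym X) (x : X) : nbhs s [set t : Sym X | t x = s x].
Proof. by move: x; apply/sym_cvgP. Qed.

Fact sym_mul_continuous : continuous (fun p : Sym X * Sym X => p.1 * p.2).
Proof.
move=> [s t]; apply/sym_cvgP => x /=.
exists ([set s' : Sym X | s' (t x) = s (t x)], [set t' : Sym X | t' x = t x]).
  by split; exact: sym_nbhs.
by move=> [s' t'] /= [+ t'x]; rewrite -t'x.
Qed.

Fact sym_inv_continuous : continuous (fun s : Sym X => s^-1).
Proof.
move=> s; apply/sym_cvgP => [|x].
  by apply: fmap_filter; exact: (@nbhs_filter (Sym X) s).
apply: filterS (sym_nbhs s (s^-1 x)) => t /= tx.
by apply: (can_inj (symK t)); rewrite symVK tx [RHS]symVK.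
Qed.

HB.instance Definition _ :=
  isTopGroup.Build (Sym X) sym_mul_continuous sym_inv_continuous.

End SymTopology.

Definition dsum (X : choiceType) (H : groupType) : Type :=
  {fsfun X -> H with 1}.

Section DirectSum.
Variables (X : choiceType) (H : groupType).
Implicit Types f g : dsum X H.

HB.instance Definition _ := Choice.on (dsum X H).

Definition dsum_fun f : X -> H := f.
Local Coercion dsum_fun : dsum >-> Funclass.

Lemma dsumP f g : f =1 g -> f = g.
Proof. by move=> fg; apply/fsfunP. Qed.

Definition dsum_one : dsum X H := [fsfun with 1].

Definition dsum_mul f g : dsum X H :=
  [fsfun x in (finsupp f `|` finsupp g)%fset => f x * g x | 1].

Definition dsum_inv f : dsum X H := [fsfun x in finsupp f => (f x)^-1 | 1].

Definition dsum_act (s : Sym X) f : dsum X H :=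
  [fsfun x in [fset s y | y in finsupp f]%fset => f (s^-1 x) | 1].

Lemma dsum_oneE x : dsum_one x = 1.
Proof. by rewrite /dsum_fun fsfun0E. Qed.

Lemma dsum_mulE f g x : dsum_mul f g x = f x * g x.
Proof.
rewrite {1}/dsum_fun fsfunE inE; case: ifP => // /negbT.
rewrite negb_or => /andP[xf xg].
by rewrite /dsum_fun (fsfun_dflt xf) (fsfun_dflt xg) mulg1.
Qed.

Lemma dsum_invE f x : dsum_inv f x = (f x)^-1.
Proof.
rewrite {1}/dsum_fun fsfunE; case: ifP => // /negbT xf.
by rewrite /dsum_fun (fsfun_dflt xf) invg1.
Qed.

Lemma dsum_actE s f x : dsum_act s f x = f (s^-1 x).
Proof.
rewrite {1}/dsum_fun fsfunE; case: ifP => // /negbT xf.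
rewrite /dsum_fun; case: finsuppP => // kf; case/negP: xf.
by apply/imfsetP; exists (s^-1 x) => //; rewrite [RHS]symVK.
Qed.

Fact dsum_mulA : associative dsum_mul.
Proof. by move=> f g h; apply: dsumP => x; rewrite !dsum_mulE mulgA. Qed.

Fact dsum_mul1 : left_id dsum_one dsum_mul.
Proof. by move=> f; apply: dsumP => x; rewrite dsum_mulE dsum_oneE mul1g. Qed.

Fact dsum_1mul : right_id dsum_one dsum_mul.
Proof. by move=> f; apply: dsumP => x; rewrite dsum_mulE dsum_oneE mulg1. Qed.

Fact dsum_mulV : left_inverse dsum_one dsum_inv dsum_mul.
Proof.
move=> f; apply: dsumP => x.
by rewrite dsum_mulE dsum_invE dsum_oneE mulVg.
Qed.

Fact dsum_Vmul : right_inverse dsum_one dsum_inv dsum_mul.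
Proof.
move=> f; apply: dsumP => x.
by rewrite dsum_mulE dsum_invE dsum_oneE mulgV.
Qed.

HB.instance Definition _ := isGroup.Build (dsum X H)
  dsum_mulA dsum_mul1 dsum_1mul dsum_mulV dsum_Vmul.

Lemma dsum_act1 f : dsum_act 1 f = f.
Proof. by apply: dsumP => x; rewrite dsum_actE. Qed.

Lemma dsum_actM s t f : dsum_act (s * t) f = dsum_act s (dsum_act t f).
Proof. by apply: dsumP => x; rewrite !dsum_actE. Qed.

Lemma dsum_act_mul s f g : dsum_act s (f * g) = dsum_act s f * dsum_act s g.
Proof.
by apply: dsumP => x; rewrite [RHS]dsum_mulE !dsum_actE [LHS]dsum_mulE.
Qed.

Lemma dsum_act_one s : dsum_act s 1 = 1.
Proof. by apply: dsumP => x; rewrite dsum_actE !dsum_oneE. Qed.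

Lemma dsum_act_nbhs (s : Sym X) f :
  nbhs s [set t : Sym X | dsum_act t f = dsum_act s f].
Proof.
have nbhs_seq (r : seq X) :
    nbhs s [set t : Sym X | forall x, x \in r -> t x = s x].
  elim: r => [|x r IH]; first by apply: filterS filterT.
  apply: filterS2 IH (sym_nbhs s x) => t tr /= tx y.
  by rewrite inE => /predU1P[->//|/tr].
apply: filterS (nbhs_seq (finsupp f)) => t ts; apply: dsumP => x; rewrite !dsum_actE.
have aux (u v : Sym X) : (forall x, x \in finsupp f -> u x = v x) ->
    (u^-1 x) \in finsupp f -> f (u^-1 x) = f (v^-1 x).
  move=> uv uxf; congr (dsum_fun f _); apply: (can_inj (symK v)).
  by rewrite -uv// [LHS]symVK [RHS]symVK.
have [tx|tx] := boolP (t^-1 x \in finsupp f); first exact: aux.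
have [sx|sx] := boolP (s^-1 x \in finsupp f).
  by apply/esym/aux => // y yf; rewrite ts.
by rewrite /dsum_fun !fsfun_dflt.
Qed.

End DirectSum.

Section Wreath.
Variables (X : choiceType) (H : groupType) (G : groupClosed (Sym X)).

(** The alias keeps the semidirect product apart from the direct product of the
    two factors. *)
Definition wreath : Type := (dsum X H * subgroup G)%type.

HB.instance Definition _ := Choice.on wreath.

Implicit Types u v w : wreath.

Definition wreath_one : wreath := (1, 1).

Definition wreath_mul u v : wreath :=
  (u.1 * dsum_act (subgroup_val u.2) v.1, u.2 * v.2).

Definition wreath_inv u : wreath :=
  (dsum_act (subgroup_val u.2^-1) u.1^-1, u.2^-1).

Fact wreath_mulA : associative wreath_mul.
Proof.
move=> u v w; congr (_, _); last exact: mulgA.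
by rewrite /= dsum_act_mul mulgA -dsum_actM.
Qed.

Fact wreath_mul1 : left_id wreath_one wreath_mul.
Proof. by case=> f g; rewrite /wreath_mul/= dsum_act1 !mul1g. Qed.

Fact wreath_1mul : right_id wreath_one wreath_mul.
Proof. by case=> f g; rewrite /wreath_mul/= dsum_act_one !mulg1. Qed.

Fact wreath_mulV : left_inverse wreath_one wreath_inv wreath_mul.
Proof.
case=> f g; rewrite /wreath_mul/= -dsum_act_mul mulVg dsum_act_one.
by rewrite mulVg.
Qed.

Fact wreath_Vmul : right_inverse wreath_one wreath_inv wreath_mul.
Proof.
case=> f g; rewrite /wreath_mul/= -dsum_actM -[subgroup_val g * _]/(subgroup_val (g * g^-1)).
by rewrite mulgV dsum_act1 mulgV.
Qed.

HB.instance Definition _ := isGroup.Build wreath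
  wreath_mulA wreath_mul1 wreath_1mul wreath_mulV wreath_Vmul.

HB.instance Definition _ := Topological.copy wreath
  (discrete_topology (dsum X H) * subgroup G)%type.

Lemma wreath_cvgP (F : set_system wreath) (u : wreath) : Filter F ->
  F --> u <-> F [set v | v.1 = u.1] /\ snd @ F --> u.2.
Proof.
move=> FF; split.
  move=> Fu; split.
    apply: Fu; exists ([set u.1], setT); last by move=> v [].
    by split; [exact: (@discrete_set1 (discrete_topology _)) | exact: filterT].
  move=> A Au; apply: Fu; exists (setT, A); last by move=> v [].
  by split => //; exact: filterT.
move=> [F1 F2] A [[B C] /= [Bu Cu] BCA].
have FC : F (snd @^-1` C) by exact: F2 Cu.
apply: filterS2 F1 FC => v /= v1 Cv; apply: (BCA v); split => //=.
by rewrite v1; exact: (@nbhs_singleton (discrete_topology _) _ _ Bu).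
Qed.

Lemma wreath_act_nbhs (g : subgroup G) (f : dsum X H) :
  nbhs g [set k : subgroup G | dsum_act (subgroup_val k) f = dsum_act (subgroup_val g) f].
Proof.
exact: (@initial_continuous _ _ (@subgroup_val _ G) g _ (dsum_act_nbhs _ _)).
Qed.

Lemma wreath_fst_nbhs u : nbhs u [set v : wreath | v.1 = u.1].
Proof. by have [] := (wreath_cvgP u (nbhs_filter u)).1 cvg_id. Qed.

Lemma wreath_snd_continuous : continuous (snd : wreath -> subgroup G).
Proof. by move=> u; have [] := (wreath_cvgP u (nbhs_filter u)).1 cvg_id. Qed.

Fact wreath_mul_continuous : continuous (fun p : wreath * wreath => p.1 * p.2).
Proof.
move=> [u v]; apply/wreath_cvgP; split=> [|A /(@mulg_continuous (subgroup G) (u.2, v.2))].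
  exists ([set u' | u'.1 = u.1 /\ dsum_act (subgroup_val u'.2) v.1 =
      dsum_act (subgroup_val u.2) v.1], [set v' | v'.1 = v.1]).
    split; last exact: wreath_fst_nbhs.
    apply: filterI; first exact: wreath_fst_nbhs.
    exact: (wreath_snd_continuous (wreath_act_nbhs _ _)).
  by case=> u' v' /= [[-> E] ->]; rewrite E.
move=> [[B C] /= [Bu Cv] BCA].
exists (snd @^-1` B, snd @^-1` C).
  by split; [exact: (wreath_snd_continuous Bu) | exact: (wreath_snd_continuous Cv)].
by case=> u' v' /= [Bu' Cv']; exact: (BCA (u'.2, v'.2)).
Qed.

Fact wreath_inv_continuous : continuous (fun u : wreath => u^-1).
Proof.
move=> u; apply/wreath_cvgP.
have uV A : nbhs (u.2^-1) A -> nbhs u [set v : wreath | A v.2^-1].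
  by move=> /invg_continuous uA; exact: (wreath_snd_continuous uA).
split; last exact: uV.
apply: filterS2 (wreath_fst_nbhs u) (uV _ (wreath_act_nbhs u.2^-1 u.1^-1)).
by move=> v /= v1 Ev; rewrite -Ev -v1.
Qed.

HB.instance Definition _ :=
  isTopGroup.Build wreath wreath_mul_continuous wreath_inv_continuous.

Definition wreath_act (w : wreath) (f : dsum X H) : dsum X H :=
  w.1 * dsum_act (subgroup_val w.2) f.

End Wreath.

Section Means.
Variable R : realType.
Local Open Scope ring_scope.

Definition linfty (Z : Type) : set (Z -> R) := bounded_fun.

(** A mean on [A] is represented by a function [mu] defined on all of [Z -> R]
    whose values outside [A] are irrelevant; [A] is meant to be a linear
    subspace of [linfty Z] containing the constant functions. *)
Definition is_mean (Z : Type) (A : set (Z -> R)) (mu : (Z -> R) -> R) : Prop :=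
  [/\ forall f g, A f -> A g -> mu (fun z => f z + g z) = mu f + mu g,
      forall c f, A f -> mu (fun z => c * f z) = c * mu f,
      forall f, A f -> (forall z, 0 <= f z) -> 0 <= mu f
    & mu (fun=> 1) = 1].

Definition amenable (H : groupType) : Prop :=
  exists2 mu, is_mean (@linfty H) mu &
    forall f (h : H), linfty f -> mu (f \o (fun x => (h * x)%g)) = mu f.

Definition LUCB (G : topGroupType) : set (G -> R) :=
  [set f | linfty f /\
    forall e : R, 0 < e -> exists2 U : set G, nbhs (1%g : G) U &
      forall x y : G, U (x^-1 * y)%g -> `|f x - f y| <= e].

Definition skew_amenable (G : topGroupType) : Prop :=
  exists2 mu, is_mean (@LUCB G) mu &
    forall f (g : G), LUCB f -> mu (f \o (fun x => (g * x)%g)) = mu f.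

(** In the group ['Z_2], multiplicatively written, [1%g] is the residue [0] and
    the product is addition modulo [2]. *)
Definition extensively_amenable (X : choiceType) (G : groupClosed (Sym X)) :
    Prop :=
  exists2 mu, is_mean (@linfty (dsum X 'Z_2)) mu &
    forall f (w : wreath 'Z_2 G), linfty f -> mu (f \o wreath_act w) = mu f.

End Means.

(* Main.v *)
Require Import Defs.
From mathcomp Require Import all_boot all_order all_algebra fingroup finmap.
From mathcomp Require Import all_classical all_reals all_analysis.
From mathcomp Require Import lra.

(** Both conditions are equivalent to the existence of one object: a mean [m]
    on the bounded functions of finite sequences of points of [X] that is
    invariant under [G] and gives full weight, for each finite [E], to the
    sequences that contain [E] (called absorbing below).  A sequence drawn from
    [m] is a finite subset of [X], listed in some order, that is almost surely
    larger than any prescribed one.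

    From a mean on [H^(X)] that is invariant under [H^(X) ><| G] one gets [m]
    as follows ([absorbing_of_wreath_mean]).  Draw a random function, take its
    support, and list it in a uniformly random order; this is [G]-equivariant.
    As [H] has an element [h <> 1], left multiplication by [h] at [x] moves the
    event that the function is [1] at [x] off itself, so this event has mean at
    most [1/2].  The concatenation of [n] independent such lists misses [x] with
    mean at most [2^-n], and a limit along an ultrafilter of [n] misses no point.

    Conversely, let [H] be amenable ([wreath_mean_of_absorbing]).  Draw a
    sequence from [m] and multiply the functions supported at its
    successive points with values drawn from an invariant mean on [H].  The
    result is invariant under left multiplication by any function whose support
    lies in the sequence, that is, by any given function almost surely.  Thus the
    existence of an invariant mean on [H^(X)] is the same for all non-trivial
    amenable [H]; the residues modulo two are the case of extensive amenability.

    It remains to compare such a mean [nu] on [H^(X)] with skew-amenability.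
    A function on the wreath product that depends on the [H^(X)]-coordinate
    alone is left-uniformly continuous, because the subgroup [G] is open,
    [H^(X)] being discrete, and right translation by [G] does not change this
    coordinate; hence skew-amenability gives [nu] ([wreath_mean_of_skew_amenable]).  In the other direction [m] also makes
    [G] itself skew-amenable ([subgroup_mean]), with a mean [kappa], and then
    integrating first over [G] by [kappa] and next over [H^(X)] by [nu] is
    invariant under left translations.

    For [subgroup_mean], a left-uniformly continuous function on [G] is nearly a
    function of the restriction of [k] to a finite [E], so an invariant mean for
    such functions is needed for each [E].  It is built one point [x] at a time:
    having chosen [k] up to agreement on [E], draw a sequence from [m] and
    redirect [k] to an element that agrees with it on [E] and sends [x] to the
    first possible point of the sequence. *)

Set Implicit Arguments.
Unset Strict Implicit.
Unset Printing Implicit Defensive.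

Import Order.TTheory GRing.Theory Num.Theory.
Import numFieldNormedType.Exports.

Local Open Scope classical_set_scope.
Local Open Scope ring_scope.

(** * Means on bounded functions *)

Section MeanTheory.
Variable R : realType.

Lemma linftyP (Z : Type) (f : Z -> R) :
  linfty f <-> exists C : R, forall z, `|f z| <= C.
Proof.
split=> [[M [_ fM]]|[C fC]].
  by exists (M + 1) => z; apply: fM => //; rewrite ltrDl.
exists C; split; first exact: num_real.
by move=> x Cx z _; exact: le_trans (fC z) (ltW Cx).
Qed.

Lemma linfty_cst (Z : Type) (c : R) : linfty (fun _ : Z => c).
Proof. by apply/linftyP; exists `|c|. Qed.

Lemma linftyD (Z : Type) (f g : Z -> R) :
  linfty f -> linfty g -> linfty (fun z => f z + g z).
Proof.
move=> /linftyP[C fC] /linftyP[D gD]; apply/linftyP; exists (C + D) => z.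
by rewrite (le_trans (ler_normD _ _))// lerD.
Qed.

Lemma linftyZ (Z : Type) (c : R) (f : Z -> R) :
  linfty f -> linfty (fun z => c * f z).
Proof.
move=> /linftyP[C fC]; apply/linftyP; exists (`|c| * C) => z.
by rewrite normrM ler_wpM2l.
Qed.

Lemma linfty_comp (Y Z : Type) (p : Y -> Z) (f : Z -> R) :
  linfty f -> linfty (fun y => f (p y)).
Proof. by move=> /linftyP[C fC]; apply/linftyP; exists C => y. Qed.

Lemma linfty_if (Z : Type) (b : Z -> bool) (f g : Z -> R) :
  linfty f -> linfty g -> linfty (fun z => if b z then f z else g z).
Proof.
move=> /linftyP[C fC] /linftyP[D gD]; apply/linftyP; exists (Num.max C D) => z.
by case: ifP => _; rewrite le_max ?fC ?gD ?orbT.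
Qed.

Definition mean (Z : Type) (mu : (Z -> R) -> R) := is_mean (@linfty R Z) mu.

Section OneMean.
Variables (Z : Type) (mu : (Z -> R) -> R).
Hypothesis mu_mean : mean mu.

Lemma mean_cst c : mu (fun=> c) = c.
Proof.
have [_ muZ _ mu1] := mu_mean.
have <- : (fun _ : Z => c * 1) = (fun=> c) by apply/funext => z; rewrite mulr1.
by rewrite muZ ?mu1 ?mulr1//; exact: linfty_cst.
Qed.

Lemma meanB f g : linfty f -> linfty g ->
  mu (fun z => f z - g z) = mu f - mu g.
Proof.
have [muD muZ _ _] := mu_mean => lf lg.
have -> : (fun z => f z - g z) = (fun z => f z + -1 * g z).
  by apply/funext => z; rewrite mulN1r.
by rewrite muD ?muZ ?mulN1r//; exact: linftyZ.
Qed.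

Lemma mean_le f g : linfty f -> linfty g -> (forall z, f z <= g z) ->
  mu f <= mu g.
Proof.
move=> lf lg fg; have [_ _ mu_ge0 _] := mu_mean.
rewrite -subr_ge0 -meanB//; apply: mu_ge0 => [|z]; last by rewrite subr_ge0.
apply: linftyD => //; have -> : (fun z => - f z) = (fun z => -1 * f z).
  by apply/funext => z; rewrite mulN1r.
exact: linftyZ.
Qed.

Lemma mean_dist f g e : linfty f -> linfty g ->
  (forall z, `|f z - g z| <= e) -> `|mu f - mu g| <= e.
Proof.
move=> lf lg fge; have [muD muZ _ _] := mu_mean.
have mule h c : linfty h -> mu (fun z => h z + c) = mu h + c.
  by move=> lh; rewrite muD ?mean_cst//; exact: linfty_cst.
have lc (h : Z -> R) c : linfty h -> linfty (fun z => h z + c).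
  by move=> lh; apply: linftyD => //; exact: linfty_cst.
have fgz z : g z + - e <= f z /\ f z <= g z + e.
  by have := fge z; rewrite ler_distl => /andP.
rewrite ler_distl -!mule//; apply/andP.
by split; apply: mean_le => // [|z]; [exact: lc|case: (fgz z)|exact: lc|case: (fgz z)].
Qed.

Lemma mean_bounded f C : (forall z, `|f z| <= C) -> `|mu f| <= C.
Proof.
move=> fC; rewrite -[mu f]subr0 -(mean_cst 0); apply: mean_dist.
- by apply/linftyP; exists C.
- exact: linfty_cst.
- by move=> z; rewrite subr0.
Qed.

End OneMean.

Lemma linfty_mean (Y Z : Type) (k : Y -> (Z -> R) -> R) (f : Z -> R) :
  (forall y, mean (k y)) -> linfty f -> linfty (fun y => k y f).
Proof.
move=> km /linftyP[C fC]; apply/linftyP; exists C => y.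
exact: (mean_bounded (km y)).
Qed.

Lemma mean_dirac (Z : Type) (z : Z) : mean (fun f => f z).
Proof. by split=> // f _; apply. Qed.

(** Drawing [y] from [nu] and then a point from [k y].  Means are only finitely
    additive, so the order of integration in such iterated means matters. *)
Lemma mean_bind (Y Z : Type) (nu : (Y -> R) -> R) (k : Y -> (Z -> R) -> R) :
  mean nu -> (forall y, mean (k y)) -> mean (fun f => nu (fun y => k y f)).
Proof.
move=> num km; have [nuD nuZ nu_ge0 nu1] := num.
have lk f : linfty f -> linfty (fun y => k y f).
  exact: linfty_mean.
split.
- move=> f g lf lg; rewrite -nuD; [|exact: lk..].
  by congr nu; apply/funext => y; have [kD _ _ _] := km y; rewrite kD.
- move=> c f lf; rewrite -nuZ; [|exact: lk].
  by congr nu; apply/funext => y; have [_ kZ _ _] := km y; rewrite kZ.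
- move=> f lf f0; apply: nu_ge0 => [|y]; first exact: lk.
  by have [_ _ k0 _] := km y; exact: k0.
- rewrite -[RHS]nu1.
  by congr nu; apply/funext => y; have [_ _ _ k1] := km y; rewrite k1.
Qed.

Lemma mean_map (Y Z : Type) (p : Y -> Z) (nu : (Y -> R) -> R) :
  mean nu -> mean (fun f => nu (fun y => f (p y))).
Proof. by move=> num; apply: mean_bind => // y; exact: mean_dirac. Qed.

Lemma mean_sub (Z : Type) (A : set (Z -> R)) (mu : (Z -> R) -> R) :
  A `<=` linfty (Z:=Z) -> mean mu -> is_mean A mu.
Proof.
move=> Al [muD muZ mu0 mu1]; split=> // [f g /Al lf /Al lg|c f /Al lf|f /Al lf].
- exact: muD.
- exact: muZ.
- exact: mu0.
Qed.

Lemma mean_unif (Z : eqType) (r : seq Z) : r != [::] ->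
  mean (fun f => (\sum_(z <- r) f z) / (size r)%:R).
Proof.
rewrite -size_eq0 => r0; split.
- by move=> f g _ _; rewrite big_split/= mulrDl.
- by move=> c f _; rewrite -mulr_sumr mulrA.
- by move=> f _ f0; rewrite divr_ge0// sumr_ge0.
- by rewrite big_const_seq count_predT iter_addr_0 divff// pnatr_eq0.
Qed.

(** The values stay in a segment, which is compact, so the image filter has a
    cluster point; an ultrafilter converges to its cluster points. *)
Lemma ultra_cvg (I : Type) (U : set_system I) (u : I -> R) :
  UltraFilter U -> linfty u -> cvg (u @ U).
Proof.
move=> UU /linftyP[C uC].
have UuC : (u @ U) [set` `[- C, C]].
  by apply: (@filterE _ U) => i; rewrite /= in_itv/= -ler_norml; exact: uC.
have [x [_ clx]] := @segment_compact R (- C) C (u @ U) _ UuC.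
apply/cvg_ex; exists x => A Ax.
have [//|UA] := in_ultra_setVsetC (u @^-1` A) UU.
by have [y []] := clx (~` A) A UA Ax.
Qed.

(** Weak-star compactness of the set of means, in the form in which it is used:
    identities that hold for the [mu i] up to an error vanishing along [F]
    become exact for the limit. *)
Lemma mean_limit (I Z : Type) (F : set_system I) (mu : I -> (Z -> R) -> R) :
    ProperFilter F -> (forall i, mean (mu i)) ->
  exists2 m, mean m & forall f g, linfty f -> linfty g ->
    (forall e, 0 < e -> F [set i | `|mu i f - mu i g| <= e]) -> m f = m g.
Proof.
move=> FF mum; have [U [UU FU]] := ultraFilterLemma FF.
have UP : ProperFilter U by exact: ultra_proper.
have cv f : linfty f -> cvg ((fun i => mu i f) @ U).
  by move=> lf; apply: ultra_cvg => //; exact: linfty_mean.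
have mm : mean (fun f => lim ((fun i => mu i f) @ U)).
  split.
  - move=> f g lf lg; apply/cvg_lim => //.
    rewrite (_ : (fun i => _) = (fun i => mu i f + mu i g)).
      by apply: cvgD; exact: cv.
    by apply/funext => i; have [D _ _ _] := mum i; rewrite D.
  - move=> c f lf; apply/cvg_lim => //.
    rewrite (_ : (fun i => _) = (fun i => c * mu i f)).
      by apply: cvgMl_tmp; exact: cv.
    by apply/funext => i; have [_ M _ _] := mum i; rewrite M.
  - move=> f lf f0; apply: limr_ge; first exact: cv.
    by apply: nearW => i; have [_ _ P _] := mum i; exact: P.
  - apply/cvg_lim => //.
    rewrite (_ : (fun i => _) = (fun=> 1)); first exact: cvg_cst.
    by apply/funext => i; have [_ _ _ ->] := mum i.
exists (fun f => lim ((fun i => mu i f) @ U)) => // f g lf lg fg.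
apply/eqP; rewrite -subr_eq0; apply/eqP.
rewrite -limB; [|exact: cv..].
apply/cvg_lim => //; apply/cvgr0Pnorm_le => e e0.
exact: FU (fg e e0).
Qed.

End MeanTheory.

(** * From absorbing sequences to invariant means on finitely supported functions *)

(** Sequences rather than finite sets: both uses below need an order on the
    points, and keeping it in the sequence makes the equivariance under [G]
    automatic. *)
Definition absorbing (R : realType) (X : choiceType) (G : groupClosed (Sym X))
    (m : (seq X -> R) -> R) : Prop :=
  [/\ mean m,
      forall (g : subgroup G) f, linfty f ->
        m (fun s => f (map (subgroup_val g) s)) = m f
    & forall (E : seq X) f f', linfty f -> linfty f' ->
        (forall s : seq X, {subset E <= s} -> f s = f' s) -> m f = m f'].

Definition wreath_mean (R : realType) (X : choiceType) (G : groupClosed (Sym X))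
    (H : groupType) (nu : (dsum X H -> R) -> R) : Prop :=
  mean nu /\ forall (w : wreath H G) f, linfty f ->
    nu (fun a => f (wreath_act w a)) = nu f.

Section DirectSumPoints.
Variables (X : choiceType) (H : groupType).
Implicit Types a b : dsum X H.
Local Coercion dsum_fun : dsum >-> Funclass.

Definition dsum_point (x : X) (h : H) : dsum X H :=
  [fsfun y in [fset x]%fset => h | 1%g].

Lemma dsum_pointE x h y : dsum_point x h y = if y == x then h else 1%g.
Proof. by rewrite {1}/dsum_fun fsfunE inE. Qed.

Lemma dsum_prodE a b x : dsum_fun (a * b)%g x = (a x * b x)%g.
Proof. exact: dsum_mulE. Qed.

Lemma dsum_unitE x : dsum_fun (1%g : dsum X H) x = 1%g.
Proof. exact: dsum_oneE. Qed.

Lemma dsum_act_point (g : Sym X) x h :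
  dsum_act g (dsum_point x h) = dsum_point (g x) h.
Proof.
apply: dsumP => y; rewrite dsum_actE !dsum_pointE; congr (if _ then _ else _).
by apply/eqP/eqP => [<-|->]; [rewrite [RHS]symVK | rewrite [LHS]symK].
Qed.

(** Multiplication by [a] splits into multiplication of the value at [x] by
    [a x] and multiplication by the part of [a] off [x], which commutes with
    functions supported at [x]. *)
Lemma dsum_mul_point a x h b :
  (a * (dsum_point x h * b) =
   dsum_point x (a x * h) * ((dsum_point x (a x)^-1 * a) * b))%g.
Proof.
apply: dsumP => y; rewrite !dsum_prodE !dsum_pointE.
by case: eqP => [->|_]; rewrite ?mul1g// -!mulgA mulKg.
Qed.

End DirectSumPoints.

Section IteratedMean.
Variables (R : realType) (X : choiceType) (H : groupType).
Variable eta : (H -> R) -> R.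
Hypothesis eta_mean : mean eta.

(** The product of independent functions supported at the successive points of
    [s], with values drawn from [eta]. *)
Fixpoint iter_mean (s : seq X) (f : dsum X H -> R) : R :=
  if s is x :: s' then
    eta (fun h => iter_mean s' (fun b => f (dsum_point x h * b)%g))
  else f 1%g.

Lemma iter_mean_mean s : mean (iter_mean s).
Proof.
elim: s => [|x s IH]; first exact: mean_dirac.
apply: (@mean_bind _ _ _ _ (fun h f => iter_mean s (fun b => f (dsum_point x h * b)%g))) => // h.
exact: mean_map.
Qed.

Lemma iter_mean_act (g : Sym X) s f :
  iter_mean (map g s) f = iter_mean s (fun b => f (dsum_act g b)).
Proof.
elim: s f => [|x s IH] f /=; first by rewrite dsum_act_one.
congr eta; apply/funext => h; rewrite IH; congr iter_mean; apply/funext => b.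
by rewrite dsum_act_mul dsum_act_point.
Qed.

Hypothesis eta_inv : forall f (h : H), linfty f ->
  eta (f \o (fun x => (h * x)%g)) = eta f.

(** At the first occurrence of [x] in [s] the factor [a x] is absorbed by the
    invariance of [eta]; the rest of [a] commutes past and is absorbed further on. *)
Lemma iter_mean_mul (a : dsum X H) s f :
    linfty f -> (forall x, x \notin s -> dsum_fun a x = 1%g) ->
  iter_mean s (fun b => f (a * b)%g) = iter_mean s f.
Proof.
elim: s a f => [|x s IH] a f lf as1 /=.
  rewrite (_ : a = 1%g) ?mul1g//.
  by apply: dsumP => x; rewrite dsum_unitE as1.
have lfx h : linfty (fun b => f (dsum_point x h * b)%g) by exact: linfty_comp.
rewrite -[RHS](@eta_inv _ (dsum_fun a x)); last first.
  have [C fC] := (linftyP f).1 lf.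
  by apply/linftyP; exists C => h; apply: (mean_bounded (iter_mean_mean s)).
congr eta; apply/funext => h /=.
rewrite -[RHS](IH (dsum_point x (dsum_fun a x)^-1 * a)%g) => [||y ys].
- by congr iter_mean; apply/funext => b; rewrite dsum_mul_point.
- exact: lfx.
- rewrite dsum_prodE dsum_pointE; case: eqP => [->|/eqP yx].
    by rewrite mulVg.
  by rewrite mul1g as1// inE negb_or yx.
Qed.

End IteratedMean.

(** The mean draws [s] from [m] and then a function from [iter_mean eta s].  It
    is invariant under [G] because [m] is, and under multiplication by [a]
    because almost every [s] contains the support of [a]. *)
Lemma wreath_mean_of_absorbing (R : realType) (X : choiceType)
    (G : groupClosed (Sym X)) (H : groupType) (m : (seq X -> R) -> R) :
    absorbing G m -> amenable R H ->
  exists nu : (dsum X H -> R) -> R, wreath_mean G nu.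
Proof.
move=> [mm m_inv m_abs] [eta etam eta_inv].
have im := iter_mean_mean etam.
exists (fun f => m (fun s => iter_mean eta s f)); split.
  exact: mean_bind.
move=> [a g] f lf; rewrite /wreath_act/=.
have lim f' : linfty f' -> linfty (fun s : seq X => iter_mean eta s f').
  exact: linfty_mean.
have laf : linfty (fun b => f (a * b)%g) by exact: linfty_comp.
transitivity (m (fun s => iter_mean eta s (fun b => f (a * b)%g))).
  rewrite -(m_inv g _ (lim _ laf)); congr m; apply/funext => s.
  by rewrite iter_mean_act.
apply: (m_abs (finsupp a)); [exact: lim..|move=> s sa].
apply: iter_mean_mul => // x xs; rewrite /dsum_fun fsfun_dflt//.
by apply: contra xs; exact: sa.
Qed.

(** * From invariant means on finitely supported functions to absorbing sequences *)

Section OrderMean.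
Variables (R : realType) (X : choiceType).
Implicit Types (r s : seq X) (f : seq X -> R).

(** Averaging over all orders of [r] makes the result insensitive to the
    order in which [r] lists its points, so that the arbitrary enumeration of a support by [finsupp]
    does not spoil equivariance. *)
Definition order_mean r f : R :=
  (\sum_(s <- permutations r) f s) / (size (permutations r))%:R.

Lemma order_mean_mean r : mean (order_mean r).
Proof.
apply: (@mean_unif R _ (permutations r)); apply/eqP => r0.
by have := perm_refl r; rewrite -mem_permutations r0.
Qed.

Lemma order_mean_perm r r' f :
  perm_eq r r' -> order_mean r f = order_mean r' f.
Proof.
move=> /perm_permutations rr'.
by rewrite /order_mean (perm_big _ rr') (perm_size rr').
Qed.

Lemma order_mean_map (g : Sym X) r f :
  order_mean (map g r) f = order_mean r (fun s => f (map g s)).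
Proof.
have gI : injective g := can_inj (symK g).
have gr : perm_eq (permutations (map g r)) (map (map g) (permutations r)).
  apply: uniq_perm => [||t]; first exact: permutations_uniq.
    by rewrite map_inj_uniq ?permutations_uniq//; exact: inj_map.
  rewrite mem_permutations -[t](mapK (symVK g)) mem_map; last exact: inj_map.
  by rewrite mem_permutations; apply/idP/idP => [/(perm_map_inj gI)//|]; exact: perm_map.
by rewrite /order_mean (perm_big _ gr) (perm_size gr) big_map size_map.
Qed.

Definition miss (x : X) s : R := (x \notin s)%:R.

Lemma miss_linfty x : linfty (miss x).
Proof.
by apply/linftyP; exists 1 => s; rewrite /miss; case: (_ \notin _); rewrite ?normr1 ?normr0.
Qed.

Lemma order_mean_miss r x : order_mean r (miss x) = miss x r.
Proof.
rewrite -[RHS](mean_cst (order_mean_mean r)); congr (_ / _).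
apply: eq_big_seq => s; rewrite mem_permutations => /perm_mem sr.
by rewrite /miss sr.
Qed.

End OrderMean.

Section SupportMean.
Variables (R : realType) (X : choiceType) (G : groupClosed (Sym X)).
Variables (H : groupType) (nu : (dsum X H -> R) -> R).
Hypothesis nu_inv : wreath_mean G nu.
Local Coercion dsum_fun : dsum >-> Funclass.

Definition support_mean (f : seq X -> R) : R :=
  nu (fun a => order_mean (finsupp a) f).

Lemma support_mean_mean : mean support_mean.
Proof.
by have [num _] := nu_inv; apply: mean_bind => // a; exact: order_mean_mean.
Qed.

Lemma support_mean_map (g : subgroup G) f : linfty f ->
  support_mean (fun s => f (map (subgroup_val g) s)) = support_mean f.
Proof.
have [num nuW] := nu_inv => lf.
have lo : linfty (fun a : dsum X H => order_mean (finsupp a) f).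
  have [C fC] := (linftyP f).1 lf.
  by apply/linftyP; exists C => a; apply: (mean_bounded (order_mean_mean _ _)).
rewrite /support_mean -(nuW (1%g, g) _ lo); congr nu; apply/funext => a.
rewrite -order_mean_map; apply: order_mean_perm.
rewrite /wreath_act/= mul1g; apply: uniq_perm => [||x].
- by rewrite map_inj_uniq ?fset_uniq//; exact: can_inj (symK _).
- exact: fset_uniq.
rewrite mem_finsupp -/(dsum_fun _ _) dsum_actE -mem_finsupp.
rewrite -[in LHS](symVK (subgroup_val g) x) mem_map//.
exact: can_inj (symK _).
Qed.

(** The functions with value [1] at [x] and those with value [h] at [x] are
    disjoint events of the same mean, hence of mean at most one half. *)
Lemma support_mean_miss x : (exists h : H, h <> 1%g) ->
  support_mean (miss R x) <= 2^-1.
Proof.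
have [num nuW] := nu_inv => -[h h1].
pose u (a : dsum X H) : R := (a x == 1%g)%:R.
have -> : support_mean (miss R x) = nu u.
  congr nu; apply/funext => a.
  by rewrite order_mean_miss /miss /u mem_finsupp negbK.
have lu : linfty u.
  apply/linftyP; exists 1 => a; rewrite /u.
  by case: (_ == _); rewrite ?normr1 ?normr0.
(* [w] sends the functions with value [h] at [x] to those with value [1]. *)
pose w : wreath H G := (dsum_point x h^-1%g, 1%g).
have luw : linfty (fun a => u (wreath_act w a)) by exact: linfty_comp.
have : nu (fun a => u a + u (wreath_act w a)) <= 1.
  rewrite -[leRHS](mean_cst num); apply: mean_le => //.
  - exact: linftyD.
  - exact: linfty_cst.
  move=> a; rewrite /u /wreath_act/= dsum_act1 dsum_prodE dsum_pointE eqxx.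
  case: eqP => [->|_]; last by rewrite add0r lern1; case: (_ == _).
  rewrite mulg1; case: eqP => [/(congr1 (fun z => z^-1)%g)|_]; last by rewrite addr0.
  by rewrite invgK invg1.
have [nuD _ _ _] := num; rewrite nuD// nuW//; lra.
Qed.

End SupportMean.

Section ConcatMean.
Variables (R : realType) (X : choiceType) (m : (seq X -> R) -> R).
Hypothesis mm : mean m.

(** The concatenation of [n] independent sequences drawn from [m]. *)
Fixpoint concat_mean (n : nat) (f : seq X -> R) : R :=
  if n is n'.+1 then m (fun s => concat_mean n' (fun t => f (s ++ t)))
  else f [::].

Lemma concat_mean_mean n : mean (concat_mean n).
Proof.
elim: n => [|n IH]; first exact: mean_dirac.
apply: (@mean_bind _ _ _ _ (fun s f => concat_mean n (fun t => f (s ++ t)))) => // s.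
exact: mean_map.
Qed.

Lemma concat_mean_map (g : X -> X) n f :
    (forall f', linfty f' -> m (fun s => f' (map g s)) = m f') -> linfty f ->
  concat_mean n (fun s => f (map g s)) = concat_mean n f.
Proof.
move=> m_inv; elim: n f => [//|n IH] f lf /=.
rewrite -[RHS]m_inv; last first.
  have [C fC] := (linftyP f).1 lf.
  by apply/linftyP; exists C => s; apply: (mean_bounded (concat_mean_mean n)).
congr m; apply/funext => s; rewrite -[RHS]IH; last exact: linfty_comp.
by congr concat_mean; apply/funext => t; rewrite map_cat.
Qed.

Lemma concat_mean_miss (x : X) n : m (miss R x) <= 2^-1 ->
  concat_mean n (miss R x) <= 2^-1 ^+ n.
Proof.
move=> mx; elim: n => [|n IH] /=; first by rewrite expr0 /miss.
have -> : (fun s => concat_mean n (fun t => miss R x (s ++ t))) =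
    (fun s => concat_mean n (miss R x) * miss R x s).
  have [_ cZ _ _] := concat_mean_mean n.
  apply/funext => s; rewrite mulrC -cZ; last exact: miss_linfty.
  congr concat_mean; apply/funext => t.
  by rewrite /miss mem_cat negb_or -mulnb natrM.
have [_ mZ m_ge0 _] := mm; have [_ _ c_ge0 _] := concat_mean_mean n.
rewrite mZ; last exact: miss_linfty.
have miss0 s : 0 <= miss R x s by exact: ler0n.
rewrite exprSr ler_pM//.
  by apply: c_ge0 => //; exact: miss_linfty.
by apply: m_ge0 => //; exact: miss_linfty.
Qed.

End ConcatMean.

Lemma absorbing_of_wreath_mean (R : realType) (X : choiceType)
    (G : groupClosed (Sym X)) (H : groupType) (nu : (dsum X H -> R) -> R) :
    (exists h : H, h <> 1%g) -> wreath_mean G nu ->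
  exists m : (seq X -> R) -> R, absorbing G m.
Proof.
move=> H1 nuW.
have sm := support_mean_mean nuW.
have cm := concat_mean_mean sm.
have [m mm m_lim] := mean_limit eventually_filter cm.
exists m; split => //.
  move=> g f lf; apply: m_lim => //; first exact: linfty_comp.
  move=> e e0; apply: filterE => n /=.
  rewrite concat_mean_map ?subrr ?normr0 ?ltW//.
  by move=> f' lf'; exact: support_mean_map.
have one x f f' : linfty f -> linfty f' ->
    (forall s : seq X, x \in s -> f s = f' s) -> m f = m f'.
  move=> lf lf' ff'; apply: m_lim => // e e0.
  have [C fC] := (linftyP f).1 lf; have [D f'D] := (linftyP f').1 lf'.
  have lmiss : linfty (fun s => (C + D) * miss R x s).
    by apply: linftyZ; exact: miss_linfty.
  have bnd n : `|concat_mean (support_mean nu) n f -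
      concat_mean (support_mean nu) n f'| <= (C + D) * 2^-1 ^+ n.
    have CD0 : 0 <= C + D.
      by rewrite addr_ge0// (le_trans _ (fC [::]), le_trans _ (f'D [::])).
    have fs s : `|f s - f' s| <= (C + D) * miss R x s.
      rewrite /miss; case: (boolP (x \in s)) => xs.
        by rewrite ff'// subrr normr0 mulr0.
      by rewrite mulr1 (le_trans (ler_normB _ _))// lerD.
    have [cD cZ _ _] := cm n.
    apply: (@le_trans _ _ ((C + D) * concat_mean (support_mean nu) n (miss R x))).
      rewrite ler_distl -cZ ?lerBlDr -?cD//; try exact: miss_linfty.
      apply/andP; split; apply: (mean_le (cm n)); rewrite //; try exact: linftyD.
        by move=> s; have := fs s; rewrite ler_distl lerBlDr => /andP[].
      by move=> s; have := fs s; rewrite ler_distl => /andP[].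
    rewrite ler_wpM2l//; apply: concat_mean_miss => //.
    exact: support_mean_miss nuW _ H1.
  have half1 : `|2^-1 : R| < 1 by rewrite ger0_norm// invf_lt1 ?ltr1n.
  have /cvgr0Pnorm_le/(_ e e0) := @cvg_geometric R (C + D) _ half1.
  apply: filterS => n; exact: le_trans (le_trans (bnd n) (ler_norm _)).
elim=> [|x E IH] f f' lf lf' ff'; first by congr m; apply/funext => s; exact: ff'.
(* Interpolate: [f2] agrees with [f] where [s] contains [x], and with [f'] where
   [s] contains [E]. *)
pose f2 s := if x \in s then f s else f' s.
have lf2 : linfty f2 by exact: linfty_if.
transitivity (m f2); first by apply: (one x) => // s xs; rewrite /f2 xs.
apply: IH => // s Es; rewrite /f2; case: ifP => // xs.
by apply: ff' => y; rewrite inE => /predU1P[->//|/Es].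
Qed.

(** * Skew-amenability of the permutation group *)

Section SubgroupMean.
Variables (R : realType) (X : choiceType) (G : groupClosed (Sym X)).
Implicit Types (g k l : subgroup G) (E s : seq X) (x y : X).

Local Notation act k := (sym_fun (subgroup_val k)).

(** Agreement on [E] is equality of cosets of the pointwise stabilizer of [E];
    a function compatible with it is a function on the orbit of the tuple
    [E] under [G]. *)
Definition agree E k l : Prop := forall x, x \in E -> act k x = act l x.

Lemma agree_sym E k l : agree E k l -> agree E l k.
Proof. by move=> kl x xE; rewrite kl. Qed.

Lemma agree_trans E k l g : agree E k l -> agree E l g -> agree E k g.
Proof. by move=> kl lg x xE; rewrite kl ?lg. Qed.

Lemma agree_mull E g k l : agree E k l -> agree E (g * k)%g (g * l)%g.
Proof. by move=> kl x xE /=; rewrite /= kl. Qed.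

(** The possible images of [x] once the images of the points of [E] under [k]
    are prescribed. *)
Definition hits E x k y : bool := `[< exists2 l, agree E k l & act l x = y >].

Lemma hits_self E x k : hits E x k (act k x).
Proof. by apply/asboolP; exists k. Qed.

Lemma hits_mull E x g k y : hits E x (g * k)%g (act g y) = hits E x k y.
Proof.
apply/asboolP/asboolP => -[l kl lx].
  exists (g^-1 * l)%g; first by rewrite -[k](mulKg g); exact: agree_mull.
  by rewrite /= lx symK.
by exists (g * l)%g; [exact: agree_mull | rewrite /= lx].
Qed.

Lemma hits_agree E x k l : agree E k l -> hits E x k = hits E x l.
Proof.
move=> kl; apply/funext => y; apply/asboolP/asboolP => -[g gE gx]; exists g => //.
  exact: agree_trans (agree_sym kl) gE.
exact: agree_trans kl gE.
Qed.

(** The default value [act k x] is itself one of the possible images of [x], and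
    it moves with [k], so that [first_hit_hits] and [first_hit_mull] hold for every
    [s]; it is used only for a negligible set of sequences. *)
Definition first_hit E x k s : X := nth (act k x) s (find (hits E x k) s).

Lemma first_hit_hits E x k s : hits E x k (first_hit E x k s).
Proof.
have [ks|ks] := boolP (has (hits E x k) s); first exact: nth_find.
by rewrite /first_hit nth_default ?hits_self// hasNfind.
Qed.

Lemma first_hit_mull E x g k s :
  first_hit E x (g * k)%g (map (act g) s) = act g (first_hit E x k s).
Proof.
rewrite /first_hit find_map (eq_find (hits_mull _ _ _ _)).
have [ks|ks] := boolP (has (hits E x k) s).
  by rewrite (nth_map (act k x))// -has_find.
by rewrite !nth_default ?size_map ?hasNfind.
Qed.

Lemma first_hit_agree E x k l s : agree E k l -> act k x \in s ->
  first_hit E x k s = first_hit E x l s.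
Proof.
move=> kl ks; rewrite /first_hit -(hits_agree x kl); apply: set_nth_default.
by rewrite -has_find; apply/hasP; exists (act k x) => //; exact: hits_self.
Qed.

(** Any choice would do: the two conditions determine the element up to
    agreement on [x :: E]. *)
Definition redirect E x k s : subgroup G :=
  xget k [set l | agree E k l /\ act l x = first_hit E x k s].

Lemma redirectP E x k s :
  agree E k (redirect E x k s) /\ act (redirect E x k s) x = first_hit E x k s.
Proof.
have /asboolP[l kl lx] := first_hit_hits E x k s.
by rewrite /redirect; case: xgetP => [_ -> //|/(_ l)[]].
Qed.

Lemma redirect_mull E x g k s :
  agree (x :: E) (g * redirect E x k s)%g
    (redirect E x (g * k)%g (map (act g) s)).
Proof.
have [kE kx] := redirectP E x k s.
have [gkE gkx] := redirectP E x (g * k)%g (map (act g) s).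
move=> y; rewrite inE => /predU1P[->|yE].
  by rewrite gkx first_hit_mull -kx.
by rewrite -gkE//= kE.
Qed.

(** As [s] contains the possible image [act k x], the first hit does not come
    from the default value, which could differ between [k] and [l]. *)
Lemma redirect_agree E x k l s : agree E k l -> act k x \in s ->
  agree (x :: E) (redirect E x k s) (redirect E x l s).
Proof.
have [kE kx] := redirectP E x k s; have [lE lx] := redirectP E x l s.
move=> kl ks y; rewrite inE => /predU1P[->|yE].
  by rewrite kx lx; exact: first_hit_agree.
by rewrite -kE// -lE// kl.
Qed.

Variable m : (seq X -> R) -> R.
Hypothesis m_abs : absorbing G m.

(** An invariant mean on the orbit of the tuple [E]: the last point of [E] is
    placed first, each further one by [redirect].  The values on functions
    that do not factor through the orbit depend on the choices in [redirect]
    and have no meaning. *)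
Fixpoint orbit_mean E (f : subgroup G -> R) : R :=
  if E is x :: E' then
    orbit_mean E' (fun k => m (fun s => f (redirect E' x k s)))
  else f 1%g.

Lemma orbit_mean_mean E : mean (orbit_mean E).
Proof.
have [mm _ _] := m_abs.
elim: E => [|x E IH]; first exact: mean_dirac.
apply: (@mean_bind _ _ _ _ (fun k f => m (fun s => f (redirect E x k s)))) => // k.
exact: mean_map.
Qed.

(** The random redirection commutes with left translation, by the invariance of
    [m], and turns a function on the orbit of [x :: E] into one on the orbit of
    [E], because almost every sequence contains [act k x]. *)
Lemma orbit_mean_mull E g (f : subgroup G -> R) : linfty f ->
    (forall k l, agree E k l -> f k = f l) ->
  orbit_mean E (fun k => f (g * k)%g) = orbit_mean E f.
Proof.
have [mm m_inv m_full] := m_abs.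
elim: E f => [|x E IH] f lf fE /=; first exact: fE.
have lfr k : linfty (fun s => f (redirect E x k s)) by exact: linfty_comp.
rewrite -[RHS]IH => [||k l kl].
- congr orbit_mean; apply/funext => k.
  rewrite -(m_inv g _ (lfr (g * k)%g)); congr m; apply/funext => s.
  exact/fE/redirect_mull.
- have [C fC] := (linftyP f).1 lf.
  by apply/linftyP; exists C => k; apply: (mean_bounded mm).
- apply: (m_full [:: act k x]) => // s ks.
  by apply/fE/redirect_agree => //; apply: ks; rewrite inE.
Qed.

(** The pointwise stabilizers of finite sets generate a filter that converges to
    [1] pointwise, so it is finer than the neighbourhood filter. *)
Lemma nbhs1_agree (U : set (subgroup G)) : nbhs (1%g : subgroup G) U ->
  exists E : seq X, forall k, agree E 1%g k -> U k.
Proof.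
pose F : set_system (Sym X) := fun A =>
  exists E, forall t : Sym X, (forall x, x \in E -> t x = x) -> A t.
have FF : Filter F.
  split.
  - by exists [::].
  - move=> A B [E AE] [E' BE']; exists (E ++ E') => t tE.
    by split; [apply: AE|apply: BE'] => x xE; rewrite tE// mem_cat xE ?orbT.
  - by move=> A B AB [E AE]; exists E => t /AE /AB.
have F1 : F --> (1%g : Sym X).
  apply/sym_cvgP => x; exists [:: x] => t tx.
  by rewrite /= tx// inE.
case=> _ [[B oB <-] B1] BU.
have [|E EB] := F1 B; first exact: open_nbhs_nbhs.
by exists E => k kE; apply/BU/EB => x xE; rewrite -kE.
Qed.

Lemma LUCB_agree (f : subgroup G -> R) e : LUCB f -> 0 < e ->
  exists E, forall k l, agree E k l -> `|f k - f l| <= e.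
Proof.
move=> [_ fU] /fU[U /nbhs1_agree[E EU] Uf]; exists E => k l kl.
apply/Uf/EU => x xE; rewrite -(mulVg k).
exact: (@agree_mull E k^-1%g k l kl x xE).
Qed.

(** A limit of the means [orbit_mean E] as [E] grows.  Up to [e / 2], a
    left-uniformly continuous function factors through the orbit of [E] once
    [E] is large: evaluate it at representatives [r k] of the agreement classes. *)
Lemma subgroup_mean : exists2 kappa : (subgroup G -> R) -> R, mean kappa &
  forall f g, LUCB f -> kappa (fun k => f (g * k)%g) = kappa f.
Proof.
pose F := filter_from setT (fun E0 => [set E : seq X | {subset E0 <= E}]).
have FF : ProperFilter F.
  apply: filter_from_proper; last by move=> E _; exists E.
  apply: filter_from_filter; first by exists [::].
  move=> E E' _ _; exists (E ++ E') => // E'' sE /=.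
  by split=> x xE; apply: sE; rewrite mem_cat xE ?orbT.
have [kappa kappam kappaF] := mean_limit FF orbit_mean_mean.
exists kappa => // f g Lf; have [lf _] := Lf.
have lgf : linfty (fun k => f (g * k)%g) by exact: linfty_comp.
apply: kappaF => // e e0.
have e2 : 0 < e / 2 by rewrite divr_gt0.
have [E0 fE0] := LUCB_agree Lf e2.
exists E0 => // E sE /=.
pose r k : subgroup G := xget 1%g [set l | agree E k l].
have kr k : agree E k (r k).
  by rewrite /r; case: xgetP => [_ -> //|/(_ k)[]].
have rE k l : agree E k l -> r k = r l.
  move=> kl; rewrite /r; congr xget; apply/seteqP; split => h /=.
    exact: agree_trans (agree_sym kl).
  exact: agree_trans kl.
have fr k : `|f k - f (r k)| <= e / 2.
  by apply: fE0 => x /sE xE; exact: kr.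
have lfr : linfty (fun k => f (r k)) by exact: linfty_comp.
have lgfr : linfty (fun k => f (r (g * k)%g)) by exact: linfty_comp.
have := orbit_mean_mull g lfr (fun k l kl => congr1 f (rE k l kl)).
have := mean_dist (orbit_mean_mean E) lf lfr fr.
have := mean_dist (orbit_mean_mean E) lgf lgfr (fun k => fr (g * k)%g).
move: (orbit_mean _ _) (orbit_mean _ _) (orbit_mean _ _) (orbit_mean _ _).
move=> a b c d; rewrite !ler_distl => /andP[? ?] /andP[? ?] ?.
by apply/andP; split; lra.
Qed.

End SubgroupMean.

(** * The wreath product *)

Lemma finite_amenable (R : realType) (F : finGroupType) : amenable R F.
Proof.
exists (fun f => (\sum_(x <- enum F) f x) / (size (enum F))%:R).
  apply: mean_unif; rewrite -size_eq0 -cardE -lt0n.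
  by apply/card_gt0P; exists 1%g.
move=> f h _; congr (_ / _); rewrite !big_enum/=.
by rewrite [RHS](reindex_inj (mulgI h)).
Qed.

Section SkewAmenability.
Variables (R : realType) (X : choiceType) (G : groupClosed (Sym X)).
Variable H : groupType.

Lemma wreath_divl_fst (v w : wreath H G) :
  (v^-1 * w)%g.1 = dsum_act (subgroup_val v.2^-1%g) (v.1^-1 * w.1)%g.
Proof. by rewrite dsum_act_mul. Qed.

(** Left translation by [(b, g)] moves [a] to [wreath_act (b, g) a] and [k] to
    [g * k].  For each fixed [a] the inner integral over [k] removes [g]; the
    outer one over [a] removes the action. *)
Lemma skew_amenable_of_wreath_mean (nu : (dsum X H -> R) -> R)
    (kappa : (subgroup G -> R) -> R) :
    wreath_mean G nu -> mean kappa ->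
    (forall f g, LUCB f -> kappa (fun k => f (g * k)%g) = kappa f) ->
  skew_amenable R (wreath H G).
Proof.
move=> [num nuW] km kinv.
have rm a : mean (fun f : wreath H G -> R => kappa (fun k => f (a, k))).
  exact: mean_map.
exists (fun f => nu (fun a => kappa (fun k => f (a, k)))).
  by apply: mean_sub => [f []//|]; exact: mean_bind.
move=> f [b g] [lf fU].
have fa a : LUCB (fun k : subgroup G => f (a, k)).
  split; first exact: linfty_comp.
  move=> e /fU[U U1 Uf].
  exists (fun k => U (1%g, k)).
    case: U1 => -[B C] /= [B1 C1] BCU; apply: filterS C1 => k Ck.
    apply: (BCU (1%g, k)); split => //.
    exact: (@nbhs_singleton (discrete_topology _) _ _ B1).
  move=> k l Ukl; apply: Uf.
  rewrite [(_ * _)%g]surjective_pairing wreath_divl_fst mulVg dsum_act_one.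
  exact: Ukl.
transitivity (nu (fun a => kappa (fun k => f (wreath_act (b, g) a, k)))).
  congr nu; apply/funext => a.
  by rewrite -(kinv _ g (fa _)).
apply: (nuW _ (fun a => kappa (fun k => f (a, k)))).
have [C fC] := (linftyP f).1 lf.
by apply/linftyP; exists C => a; apply: (mean_bounded km).
Qed.

(** The first coordinate is an equivariant map onto [H^(X)], and it
    pulls bounded functions back to left-uniformly continuous ones. *)
Lemma wreath_mean_of_skew_amenable : skew_amenable R (wreath H G) ->
  exists nu : (dsum X H -> R) -> R, wreath_mean G nu.
Proof.
move=> [mu [muD muZ mu0 mu1] mu_inv].
have Lfst (f : dsum X H -> R) : linfty f -> LUCB (fun w : wreath H G => f w.1).
  move=> lf; split; first exact: linfty_comp.
  move=> e e0; exists [set v | v.1 = (1%g : wreath H G).1].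
    exact: wreath_fst_nbhs.
  move=> v w vw; have := congr1 (dsum_act (subgroup_val v.2)) vw.
  rewrite wreath_divl_fst -dsum_actM [X in dsum_act X](mulgV (subgroup_val v.2)) dsum_act1.
  rewrite dsum_act_one => /(congr1 (mulg v.1)); rewrite mulVKg mulg1 => ->.
  by rewrite subrr normr0 ltW.
exists (fun f => mu (fun w => f w.1)); split.
  split => //.
  - by move=> f g lf lg; rewrite -muD//; exact: Lfst.
  - by move=> c f lf; rewrite -muZ//; exact: Lfst.
  - by move=> f lf f0; apply: mu0 => //; exact: Lfst.
move=> w f lf; exact: (mu_inv _ w (Lfst _ lf)).
Qed.

End SkewAmenability.

Theorem corollary4p6 (R : realType) (X : choiceType) (G : groupClosed (Sym X))
    (H : groupType) (Hnontrivial : exists h : H, h <> 1%g)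
    (Hamenable : amenable R H) :
  extensively_amenable R G <-> skew_amenable R (wreath H G).
Proof.
split=> [[nu num nuW]|/wreath_mean_of_skew_amenable[nu nuW]].
  have Z2 : exists h : 'Z_2, h <> 1%g by exists (inZp 1).
  have [|m m_abs] := absorbing_of_wreath_mean (nu := nu) (G := G) Z2.
    by split=> // w f; exact: nuW.
  have [nu' nu'W] := wreath_mean_of_absorbing m_abs Hamenable.
  have [kappa km kinv] := subgroup_mean m_abs.
  exact: skew_amenable_of_wreath_mean nu'W km kinv.
have [m m_abs] := absorbing_of_wreath_mean Hnontrivial nuW.
have [nu' [nu'm nu'W]] := wreath_mean_of_absorbing m_abs (finite_amenable R 'Z_2).
by exists nu' => // f w; exact: nu'W.
Qed.
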